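(* 1. There exists a bounded distributive lattice with two unary operations $\mathcal{A}=(A,1,0,\vee,\wedge,\neg,\sim)$, with $\sim$ a minimal negation and $\neg$ an intuitionistic negation, such that $\neg\neg\sim1\neq\sim1$. 2. There exists a $K_{im}$-algebra $\mathcal{A}=(A,1,0,\vee,\wedge,\neg,\sim)$ such that $\sim$ is not an intuitionistic negation.
   Context: On a bounded distributive lattice $(A,1,0,\vee,\wedge)$, a unary operation $n$ is a preminimal negation if $a\leq b\Rightarrow nb\leq na$, $na\wedge nb\leq n(a\vee b)$ and $n0=1$; a minimal negation if moreover $a\leq nna$ and $a\wedge b\leq c\Rightarrow a\wedge nc\leq nb$; an intuitionistic negation if moreover $a\wedge na\leq b$ for all $a,b$. A $K_{im}$-algebra is $(A,1,0,\vee,\wedge,\neg,\sim)$ with $(A,1,0,\vee,\wedge)$ a bounded distributive lattice, $\neg$ an intuitionistic negation, $\sim$ a minimal negation, and $\neg\neg\sim1=\sim1$. *)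

(* Defs.v *)
From mathcomp Require Import all_boot all_order.

Set Implicit Arguments.
Unset Strict Implicit.
Unset Printing Implicit Defensive.

Import Order.Theory.
Local Open Scope order_scope.

Record preminimal_negation (d : Order.disp_t) (A : tbDistrLatticeType d)
    (n : A -> A) : Prop := {
  negation_antitone : forall a b : A, a <= b -> n b <= n a;
  negation_join : forall a b : A, n a `&` n b <= n (a `|` b);
  negation_bot : n \bot = \top
}.

Record minimal_negation (d : Order.disp_t) (A : tbDistrLatticeType d)
    (n : A -> A) : Prop := {
  minimal_preminimal : preminimal_negation n;
  negation_double : forall a : A, a <= n (n a);
  negation_contraposition :
    forall a b c : A, a `&` b <= c -> a `&` n c <= n b
}.

Record intuitionistic_negation (d : Order.disp_t) (A : tbDistrLatticeType d)
    (n : A -> A) : Prop := {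
  intuitionistic_minimal : minimal_negation n;
  negation_explosion : forall a b : A, a `&` n a <= b
}.

(* [neg] is the intuitionistic negation and [sim] the minimal one; the bounded
   distributive lattice reduct is the library structure on [A]. *)
Record Kim_algebra (d : Order.disp_t) (A : tbDistrLatticeType d)
    (neg sim : A -> A) : Prop := {
  Kim_neg : intuitionistic_negation neg;
  Kim_sim : minimal_negation sim;
  Kim_regular : neg (neg (sim \top)) = sim \top
}.

(* Main.v *)
(** In a Heyting algebra each element [f] gives a minimal negation
    [a |-> (a -> f)], sending [\top] to [f]; it is intuitionistic when
    [f = \bot].  On the three-element chain, with [~ a = (a -> f)], the middle
    element [f] is not regular, which gives the first part; [f = \top] is
    regular but makes [~] constantly [\top], which gives the second. *)

From HB Require Import structures.
Require Import Defs.
From mathcomp Require Import all_boot all_order.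
Import Order.Theory.
Local Open Scope order_scope.

(* Heyting implication [a -> f] in a chain. *)
Definition chain_neg {d : Order.disp_t} {A : tbOrderType d} (f a : A) : A :=
  if a <= f then \top else f.

(** Residuation, the defining property of implication. Totality enters through [leIx]: a meet lies
    below [f] iff one of its arguments does. *)
Lemma le_chain_neg {d : Order.disp_t} {A : tbOrderType d} (f a x : A) :
  (x <= chain_neg f a) = (x `&` a <= f).
Proof.
rewrite /chain_neg leIx; case: ifP => [af|_]; first by rewrite lex1 orbT.
by rewrite orbF.
Qed.

Lemma chain_neg_minimal {d : Order.disp_t} {A : tbOrderType d} (f : A) :
  minimal_negation (chain_neg f).
Proof.
(* Modus ponens; with residuation it yields every law but the value at [\bot]. *)
have negP a : chain_neg f a `&` a <= f by rewrite -le_chain_neg.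
split; first split.
- move=> a b ab; rewrite le_chain_neg; apply: le_trans (negP b).
  exact: leI2.
- move=> a b; rewrite le_chain_neg meetUr leUx; apply/andP; split.
  + by apply: le_trans (negP a); rewrite leI2 ?leIl.
  + by apply: le_trans (negP b); rewrite leI2 ?leIr.
- by rewrite /chain_neg le0x.
- by move=> a; rewrite le_chain_neg meetC.
- move=> a b c abc; rewrite le_chain_neg meetAC; apply: le_trans (negP c).
  by rewrite meetC leI2.
Qed.

Lemma chain_neg_bot_intuitionistic {d : Order.disp_t} {A : tbOrderType d} :
  intuitionistic_negation (chain_neg (\bot : A)).
Proof.
split; first exact: chain_neg_minimal.
move=> a b; apply: le_trans (le0x b).
by rewrite meetC -le_chain_neg.
Qed.

(* The library's bounds and total order on ['I_n.+1] are declared separately;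
   this joins them into a [tbOrderType]. *)
HB.instance Definition _ (n : nat) := Order.POrder.on 'I_n.+1.

Theorem proposition6p9 :
  (exists (d : Order.disp_t) (A : tbDistrLatticeType d) (neg sim : A -> A),
      minimal_negation sim /\ intuitionistic_negation neg /\
      neg (neg (sim \top)) <> sim \top)
  /\
  (exists (d : Order.disp_t) (A : tbDistrLatticeType d) (neg sim : A -> A),
      Kim_algebra neg sim /\ ~ intuitionistic_negation sim).
Proof.
split; do 2!eexists; exists (chain_neg (\bot : 'I_3)).
- exists (chain_neg (Ordinal (isT : (1 < 3)%N))).
  split; first exact: chain_neg_minimal.
  split; first exact: chain_neg_bot_intuitionistic.
  (* Here [sim \top] is the middle element 1, [neg] sends it to 0 and then to 2, so the equality
     would give 2 = 1. *)
  by move/(congr1 val).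
- exists (chain_neg (\top : 'I_3)); split; last first.
    (* As [sim \top] is [\top], explosion would give [\top <= \bot]. *)
    by case=> _ /(_ \top \bot).
  split; [exact: chain_neg_bot_intuitionistic | exact: chain_neg_minimal |].
  exact: val_inj.
Qed.
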